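(* Let $f(z)=z\big(1+\sum_{n\ge1}c_nz^n\big)$ with $c_1,c_2,\dots$ regarded as independent variables, and let $f^{-1}(z)$ be its reverse series ($f\circ f^{-1}(z)=z$). For each integer $q$ write $(f^{-1}(z))^q=z^q\big(1+\sum_{n\ge1}\delta_n^qz^n\big)$ with $\delta_n^q$ polynomials in the $c_j$, and let a differential operator $L$ in the $c_j$ act on such series coefficientwise: $L[(f^{-1}(z))^q]=z^q\sum_{n\ge1}L[\delta_n^q]z^n$. Define the operators $$L_k=\partial_k+\sum_{n\ge1}(n+1)c_n\partial_{n+k}\ (k\ge1),\qquad L_0=\sum_{n\ge1}nc_n\partial_n,\qquad L_{-p}=\sum_{n\ge1}A_n^p\partial_n\ (p\ge1),$$ with $\partial_n=\partial/\partial c_n$ and $A_n^p$ as in the context. Then: (1) $L_k[f^{-1}(z)]=-[f^{-1}(z)]^{k+1}$ for $k\ge1$; (2) $L_0[f^{-1}(z)]=-f^{-1}(z)+z(f^{-1})'(z)$ and $L_{-1}[f^{-1}(z)]=-1+(1+2c_1z)(f^{-1})'(z)$; (3) $L_{-p}[f^{-1}(z)]=-[f^{-1}(z)]^{1-p}-\Lambda_p(z)(f^{-1})'(z)$ for $p\ge2$; in particular $\Lambda_p(z)$ is the unique function of the form $-z^{1-p}+\sum_{j=0}^{p-1}\alpha_jz^{1-j}$ such that $[f^{-1}(z)]^{1-p}+\Lambda_p(z)(f^{-1})'(z)$ expands as $\sum_{n\ge2}a_nz^n$; (4) $L_k[(f^{-1}(z))^{-k}]=k$ for $k\ge1$; (5)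 $L_{-p}[(f^{-1}(z))^p]=-p-\Lambda_p(z)\,\frac{d}{dz}[f^{-1}(z)]^p$ for $p\ge1$.
   Context: For $p\ge0$, $\Lambda_p$ denotes the unique function of the form $\Lambda_p(u)=-u^{1-p}+\sum_{j=0}^{p-1}\alpha_ju^{1-j}$ (with $\alpha_j$ polynomials in the $c_j$) such that the Laurent expansion at $z=0$ of $z^{1-p}f'(z)+\Lambda_p(f(z))$ contains only powers $z^n$ with $n\ge2$; e.g. $\Lambda_0(u)=-u$, $\Lambda_1(u)=-1-2c_1u$. The coefficients $A_n^p$ are defined by $z^{1-p}f'(z)+\Lambda_p(f(z))=\sum_{n\ge1}A_n^pz^{n+1}$. With these definitions $L_kf(z)=z^{k+1}f'(z)$ for $k\ge1$, $L_0f(z)=zf'(z)-f(z)$, and $L_{-p}f(z)=z^{1-p}f'(z)+\Lambda_p(f(z))$ for $p\ge1$. *)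

(* Defs.v *)
From HB Require Import structures.
From mathcomp Require Import all_boot all_order all_algebra.
Set Implicit Arguments. Unset Strict Implicit. Unset Printing Implicit Defensive.
Import Order.TTheory GRing.Theory Num.Theory.
Local Open Scope ring_scope.

(* Formal power series over A: s n = coefficient of z^n.
   Laurent series over A: maps int -> A, m |-> coefficient of z^m. *)
Section Series.
Variable A : comPzRingType.

Definition ps1 : nat -> A := fun n => (n == 0)%:R.
Definition ps_mul (a b : nat -> A) : nat -> A :=
  fun n => \sum_(i < n.+1) a i * b (n - i)%N.
Definition ps_exp (a : nat -> A) (k : nat) : nat -> A := iter k (ps_mul a) ps1.
(* inverse of a series with constant term 1: 1/a = sum_k (1 - a)^k
   (the sum is locally finite since 1 - a has zero constant term) *)
Definition ps_inv (a : nat -> A) : nat -> A :=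
  fun n => \sum_(k < n.+1) ps_exp (fun i => ps1 i - a i) k n.
Definition ps_zpow (a : nat -> A) (q : int) : nat -> A :=
  match q with
  | Posz k => ps_exp a k
  | Negz k => ps_inv (ps_exp a k.+1)
  end.

Definition zshift (k : int) (s : nat -> A) : int -> A :=
  fun m => match (m - k)%R with Posz n => s n | Negz _ => 0 end.
Definition lder (q : int) (s : nat -> A) : int -> A :=
  zshift (q - 1) (fun n => s n *~ (n%:Z + q)).
Definition lconst (a : A) : int -> A := fun m => if m == 0 then a else 0.

(* Lambda_p(z) * h(z), where Lambda_p(u) = -u^{1-p} + sum_{j<p} al_j u^{1-j} *)
Definition Lam_mul (al : nat -> A) (p : nat) (h : int -> A) : int -> A :=
  fun m => - h (m - (1 - p%:Z)) + \sum_(j < p) al j * h (m - (1 - j%:Z)).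

(* The data c_1, c_2, ...; F = 1 + sum c_n z^n, so f(z) = z F(z). *)
Definition Fser (c : nat -> A) : nat -> A := fun n => if n is 0 then 1 else c n.

(* z^{1-p} f'(z) + Lambda_p(f(z)), with Lambda_p given by coefficients al *)
Definition LamExpr (c : nat -> A) (al : nat -> A) (p : nat) : int -> A :=
  fun m => lder 1 (Fser c) (m - (1 - p%:Z))
         + (- zshift (1 - p%:Z) (ps_zpow (Fser c) (1 - p%:Z)) m
            + \sum_(j < p) al j *
                zshift (1 - j%:Z) (ps_zpow (Fser c) (1 - j%:Z)) m).

Definition Acoef (c : nat -> A) (al : nat -> A) (p n : nat) : A :=
  LamExpr c al p (n.+1)%:Z.

(* Differential operators, applied to an element x that involves only
   c_1, ..., c_N (so the infinite sums truncate at index N). *)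
Definition Lpos (c : nat -> A) (d : nat -> A -> A) (k : nat) (N : nat) (x : A) : A :=
  d k x + \sum_(1 <= i < N.+1) (i.+1)%:R * c i * d (i + k)%N x.
Definition Lzero (c : nat -> A) (d : nat -> A -> A) (N : nat) (x : A) : A :=
  \sum_(1 <= i < N.+1) i%:R * c i * d i x.
Definition Lneg (c : nat -> A) (al : nat -> A) (d : nat -> A -> A) (p : nat)
    (N : nat) (x : A) : A :=
  \sum_(1 <= i < N.+1) Acoef c al p i * d i x.

(* L[(f^{-1})^q] = z^q sum_{n>=1} L[delta_n^q] z^n, with
   (f^{-1})^q = z^q (G(z))^q, delta_n^q = coefficient n of G^q. *)
Definition Lapply (L : nat -> A -> A) (G : nat -> A) (q : int) : int -> A :=
  zshift q (fun n => if n is 0 then 0 else L n (ps_zpow G q n)).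

End Series.

(* Main.v *)
Require Import Defs.
From HB Require Import structures.
From mathcomp Require Import all_boot all_order all_algebra ring zify.
From mathcomp Require boolp.
Import Order.TTheory GRing.Theory Num.Theory.
Local Open Scope ring_scope.
Set Implicit Arguments.
Unset Strict Implicit.
Unset Printing Implicit Defensive.

(** With f = z F and g = z G, differentiate f(g(z)) = z in two ways. By d/dz,
    f'(g) g' = 1; by a derivation L of the coefficient ring, extended to series
    coefficientwise, (L f)(g) + f'(g) L g = 0. Hence L g = - (L f)(g) g', and
    every formula follows by substituting L f = z^(k+1) f', z f' - f, or
    z^(1-p) f' + Lambda_p(f), and using f(g) = z.

    The truncations of the operators cause no trouble: each truncated operator
    is a genuine derivation, and coefficient n of (L f)(g) only involves the
    coefficients of L f up to n. Negative powers of z are avoided by multiplying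
    with z^p, which turns Lambda_p into the polynomial [Lam_series]. *)

(** * The ring of formal power series *)

Definition fps (A : comPzRingType) := nat -> A.

(** Both sides run over the triangle i + j <= n. This serves associativity of the Cauchy product
    and, in [mul_fps_compE], moving a factor inside a composite. *)
Lemma sum_triangle_exchange (V : nmodType) n (H : nat -> nat -> V) :
  \sum_(i < n.+1) \sum_(j < (n - i).+1) H i j =
  \sum_(j < n.+1) \sum_(i < (n - j).+1) H i j.
Proof.
have tri (K : nat -> nat -> V) (i : 'I_n.+1) :
    \sum_(j < (n - i).+1) K i j = \sum_(j < n.+1 | (i + j <= n)%N) K i j.
  have le : ((n - i).+1 <= n.+1)%N by rewrite ltnS leq_subr.
  rewrite (big_ord_widen _ (K i) le); apply: eq_bigl => j.
  by have := ltn_ord i; lia.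
under eq_bigr do rewrite tri.
under [RHS]eq_bigr do rewrite (tri (fun j i => H i j)).
rewrite (exchange_big_dep predT) //=; apply: eq_bigr => j _.
by apply: eq_bigl => i; rewrite addnC.
Qed.

Section FormalSeries.
Variable A : comPzRingType.
Implicit Types (a : A) (s t : fps A).

Lemma fpsP s t : (forall n, s n = t n) -> s = t.
Proof. by move=> ?; apply: boolp.funext. Qed.

HB.instance Definition _ := boolp.gen_eqMixin (fps A).
HB.instance Definition _ := boolp.gen_choiceMixin (fps A).

Fact fps_addA : associative (fun s t : fps A => (fun n => s n + t n) : fps A).
Proof. by move=> s t r; apply: fpsP => n; rewrite addrA. Qed.
Fact fps_addC : commutative (fun s t : fps A => (fun n => s n + t n) : fps A).
Proof. by move=> s t; apply: fpsP => n; rewrite addrC. Qed.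
Fact fps_add0 :
  left_id ((fun=> 0) : fps A) (fun s t : fps A => (fun n => s n + t n) : fps A).
Proof. by move=> s; apply: fpsP => n; rewrite add0r. Qed.
Fact fps_addN :
  left_inverse ((fun=> 0) : fps A) (fun s : fps A => (fun n => - s n) : fps A)
    (fun s t : fps A => (fun n => s n + t n) : fps A).
Proof. by move=> s; apply: fpsP => n; rewrite addNr. Qed.
HB.instance Definition _ :=
  GRing.isZmodule.Build (fps A) fps_addA fps_addC fps_add0 fps_addN.

Fact ps_mulC : commutative (@ps_mul A : fps A -> fps A -> fps A).
Proof.
move=> s t; apply: fpsP => n; rewrite /ps_mul (reindex_inj rev_ord_inj) /=.
by apply: eq_bigr => i _; rewrite mulrC subSS subKn // -ltnS.
Qed.
Fact ps_mulA : associative (@ps_mul A : fps A -> fps A -> fps A).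
Proof.
move=> s t r; apply: fpsP => n; rewrite [in RHS]ps_mulC /ps_mul.
transitivity (\sum_(i < n.+1) \sum_(j < (n - i).+1)
                 s i * t (n - i - j)%N * r j).
  apply: eq_bigr => i _; have := ps_mulC t r.
  rewrite /ps_mul => /(congr1 (@^~ (n - i)%N)) ->.
  by rewrite big_distrr /=; apply: eq_bigr => j _; rewrite mulrCA mulrC.
rewrite (sum_triangle_exchange n (fun i j => s i * t (n - i - j)%N * r j)).
apply: eq_bigr => j _; rewrite big_distrr /=; apply: eq_bigr => i _.
by rewrite mulrC subnAC.
Qed.
Fact ps_mul1 : left_id (@ps1 A : fps A) (@ps_mul A : fps A -> fps A -> fps A).
Proof.
move=> s; apply: fpsP => n; rewrite /ps_mul big_ord_recl subn0 mul1r.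
by rewrite big1 ?addr0 // => i _; rewrite mul0r.
Qed.
Fact ps_mulDl : left_distributive (@ps_mul A : fps A -> fps A -> fps A) +%R.
Proof.
move=> s t r; apply: fpsP => n; rewrite /ps_mul -[RHS]big_split /=.
by apply: eq_bigr => i _; rewrite -mulrDl.
Qed.
HB.instance Definition _ :=
  GRing.Zmodule_isComPzRing.Build (fps A) ps_mulA ps_mulC ps_mul1 ps_mulDl.

Lemma coefpsD s t n : (s + t) n = s n + t n. Proof. by []. Qed.
Lemma coefpsN s n : (- s) n = - s n. Proof. by []. Qed.
Lemma coefps1 n : (1 : fps A) n = (n == 0%N)%:R. Proof. by []. Qed.
Lemma coefpsM s t n : (s * t) n = \sum_(i < n.+1) s i * t (n - i)%N.
Proof. by []. Qed.
Lemma coefps_sum (I : Type) (r : seq I) (P : pred I) (E : I -> fps A) n :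
  (\sum_(i <- r | P i) E i) n = \sum_(i <- r | P i) E i n.
Proof. by apply: (big_morph (fun s : fps A => s n)). Qed.

Lemma coefpsM0 s t : (s * t) 0%N = s 0%N * t 0%N.
Proof. by rewrite coefpsM big_ord1. Qed.
Lemma coefps_exp0 s k : s 0%N = 1 -> (s ^+ k) 0%N = 1.
Proof. by move=> s0; elim: k => // k IH; rewrite exprS coefpsM0 s0 IH mulr1. Qed.

Lemma ps_expE s k : ps_exp s k = s ^+ k.
Proof. by elim: k => // k IH; rewrite exprS /ps_exp /= -/(ps_exp s k) IH. Qed.

Definition fpsC a : fps A := fun n => if n is 0%N then a else 0.
Definition fpsX : fps A := fun n => (n == 1%N)%:R.
Definition fps_tail s : fps A := fun n => s n.+1.

Lemma coefpsCM a s n : (fpsC a * s) n = a * s n.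
Proof.
rewrite coefpsM big_ord_recl subn0 big1 ?addr0 // => i _; exact: mul0r.
Qed.
Lemma coefpsXM0 s : (fpsX * s) 0%N = 0.
Proof. by rewrite coefpsM0 mul0r. Qed.
Lemma coefpsXMS s n : (fpsX * s) n.+1 = s n.
Proof.
rewrite coefpsM big_ord_recl mul0r add0r big_ord_recl mul1r subSS subn0.
by rewrite big1 ?addr0 // => i _; exact: mul0r.
Qed.
Lemma coefpsXnM k s n : (fpsX ^+ k * s) n = if (n < k)%N then 0 else s (n - k)%N.
Proof.
elim: k n => [|k IH] n; first by rewrite mul1r subn0.
rewrite exprS -mulrA; case: n => [|n]; first by rewrite coefpsXM0.
by rewrite coefpsXMS IH ltnS subSS.
Qed.
Lemma fpsX_inj s t : fpsX * s = fpsX * t -> s = t.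
Proof. by move=> e; apply: fpsP => n; rewrite -[LHS]coefpsXMS e coefpsXMS. Qed.
Lemma fpsCD a b : fpsC (a + b) = fpsC a + fpsC b.
Proof. by apply: fpsP => -[|n]; rewrite coefpsD ?addr0. Qed.
Lemma fpsC0 : fpsC 0 = 0. Proof. by apply: fpsP => -[|n]. Qed.
Lemma fpsCN a : fpsC (- a) = - fpsC a.
Proof. by apply: fpsP => -[|n]; rewrite coefpsN ?oppr0. Qed.
Lemma fpsC_nat k : fpsC k%:R = k%:R.
Proof.
elim: k => [|k IH]; first by rewrite fpsC0.
by rewrite -natr1 fpsCD IH -[RHS]natr1; congr (_ + _); apply: fpsP => -[].
Qed.
Lemma fps_cons s : s = fpsC (s 0%N) + fpsX * fps_tail s.
Proof.
apply: fpsP => -[|n]; rewrite coefpsD.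
  by rewrite coefpsXM0 addr0.
by rewrite coefpsXMS add0r.
Qed.

Lemma expr_coef_small s k n : s 0%N = 0 -> (n < k)%N -> (s ^+ k) n = 0.
Proof.
by move=> s0 nk; rewrite (fps_cons s) s0 fpsC0 add0r exprMn coefpsXnM nk.
Qed.

(** Geometric series: with b = 1 - s, (1 - b)(1 + b + ... + b^n) = 1 - b^(n+1), and b^(n+1) vanishes
    up to index n because b has no constant term. *)
Lemma mul_ps_inv s : s 0%N = 1 -> s * ps_inv s = 1.
Proof.
move=> s0; set b := 1 - s; apply: fpsP => n; rewrite coefpsM.
have b0 : b 0%N = 0 by rewrite /b coefpsD coefpsN s0 subrr.
(* The length of the sum in [ps_inv] varies with the coefficient; all these sums may run up to [n],
   as the added powers of b contribute 0. *)
transitivity ((s * \sum_(k < n.+1) b ^+ k) n).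
  rewrite coefpsM; apply: eq_bigr => i _; congr (_ * _); rewrite coefps_sum.
  have le : ((n - i).+1 <= n.+1)%N by rewrite ltnS leq_subr.
  rewrite /ps_inv (big_ord_widen n.+1 (fun k => ps_exp b k (n - i)%N) le).
  rewrite big_mkcond /=; apply: eq_bigr => k _.
  rewrite ps_expE; case: ifP => // /negbT; rewrite -ltnNge => lt.
  by rewrite expr_coef_small.
have -> : s = - (b - 1) by rewrite /b; ring.
by rewrite mulNr -subrX1 opprB coefpsD coefpsN expr_coef_small // subr0.
Qed.

End FormalSeries.
Arguments fpsX {A}.

(** * Derivations of a ring *)

Definition derivation (R : pzRingType) (D : R -> R) :=
  (forall x y, D (x + y) = D x + D y) /\
  (forall x y, D (x * y) = D x * y + x * D y).

Section Derivation.
Variables (R : comPzRingType) (D : R -> R).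
Hypothesis derD : derivation D.

Lemma derivation0 : D 0 = 0.
Proof. by apply: (addIr (D 0)); rewrite -derD.1 !add0r. Qed.
Lemma derivation1 : D 1 = 0.
Proof.
have := derD.2 1 1; rewrite !mulr1 mul1r => e.
by apply: (addIr (D 1)); rewrite add0r -e.
Qed.
Lemma derivation_sum n (E : 'I_n -> R) : D (\sum_(i < n) E i) = \sum_(i < n) D (E i).
Proof. by apply: big_morph; [exact: derD.1 | exact: derivation0]. Qed.
Lemma derivationX x k : D (x ^+ k.+1) = x ^+ k *+ k.+1 * D x.
Proof.
elim: k => [|k IH]; first by rewrite mul1r.
by rewrite exprS derD.2 IH [x ^+ k.+1]exprS; ring.
Qed.
Lemma derivation_inv x y : x * y = 1 -> D y = - y ^+ 2 * D x.
Proof.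
move=> xy; have := derivation1; rewrite -xy derD.2 => e.
transitivity (y * (D x * y + x * D y) - y ^+ 2 * D x + (1 - x * y) * D y).
  by ring.
by rewrite e xy; ring.
Qed.
End Derivation.

Lemma derivation_comb (R : comPzRingType) (r : seq nat) (b : nat -> R)
    (d : nat -> R -> R) :
  (forall i, derivation (d i)) ->
  derivation (fun x => \sum_(i <- r) b i * d i x).
Proof.
move=> dd; split=> x y.
  by rewrite -big_split; apply: eq_bigr => i _; rewrite (dd i).1 mulrDr.
rewrite mulr_suml mulr_sumr -big_split; apply: eq_bigr => i _ /=.
by rewrite (dd i).2; ring.
Qed.

Lemma derivation_add (R : comPzRingType) (D E : R -> R) :
  derivation D -> derivation E -> derivation (fun x => D x + E x).
Proof.
move=> dD dE; split=> x y; rewrite ?dD.1 ?dE.1 ?dD.2 ?dE.2; ring.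
Qed.

(** * Derivations of the ring of series *)

Section SeriesDerivations.
Variable A : comPzRingType.
Implicit Types (s t : fps A).

Definition fps_lift (D : A -> A) s : fps A := fun n => D (s n).
Definition fps_deriv s : fps A := fun n => s n.+1 *+ n.+1.

Lemma derivation_lift D : derivation D -> derivation (fps_lift D).
Proof.
move=> dD; split=> s t; apply: fpsP => n; first exact: dD.1.
rewrite coefpsD !coefpsM -big_split /fps_lift coefpsM derivation_sum //.
by apply: eq_bigr => i _; exact: dD.2.
Qed.

Lemma fps_liftC D a : derivation D -> fps_lift D (fpsC a) = fpsC (D a).
Proof. by move=> dD; apply: fpsP => -[|n] //; exact: derivation0. Qed.

Lemma fps_liftX D : derivation D -> fps_lift D fpsX = 0.
Proof.
move=> dD; apply: fpsP => n; rewrite /fps_lift /fpsX.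
by case: eqP => _; [exact: derivation1 | exact: derivation0].
Qed.

Lemma coefpsXderiv s n : (fpsX * fps_deriv s) n = s n *+ n.
Proof. by case: n => [|n]; rewrite ?coefpsXM0 // coefpsXMS. Qed.

Lemma coef_derivXM s n : fps_deriv (fpsX * s) n = s n *+ n.+1.
Proof. by rewrite /fps_deriv coefpsXMS. Qed.

(** The Leibniz rule is checked for z d/dz, which scales coefficient n by n, so that it reduces to n
    = i + (n - i); the factor z is then cancelled. *)
Lemma derivation_deriv : derivation fps_deriv.
Proof.
split=> s t; first by apply: fpsP => n; exact: mulrnDl.
apply: fpsX_inj; apply: fpsP => n; rewrite coefpsXderiv.
have -> : fpsX * (fps_deriv s * t + s * fps_deriv t) =
    (fpsX * fps_deriv s) * t + s * (fpsX * fps_deriv t) by ring.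
rewrite coefpsD !coefpsM -big_split -sumrMnl; apply: eq_bigr => i _ /=.
rewrite !coefpsXderiv mulrnAl mulrnAr -mulrnDr subnKC //.
by rewrite -ltnS.
Qed.

Lemma fps_derivC a : fps_deriv (fpsC a) = 0.
Proof. by apply: fpsP => n; rewrite /fps_deriv mul0rn. Qed.

Lemma fps_derivX : fps_deriv fpsX = 1 :> fps A.
Proof. by apply: fpsP => -[|n]; rewrite /fps_deriv // mul0rn. Qed.

Lemma fps_deriv_cons s :
  fps_deriv s = fps_tail s + fpsX * fps_deriv (fps_tail s).
Proof.
by apply: fpsP => n; rewrite coefpsD coefpsXderiv /fps_deriv mulrS.
Qed.

End SeriesDerivations.

(** * Composition with z G(z) and the chain rule *)

Section Composition.
Variables (A : comPzRingType) (G : fps A).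
Implicit Types (s t : fps A).

(* The composite s(z G(z)). *)
Definition fps_comp s : fps A :=
  fun n => \sum_(i < n.+1) s i * (G ^+ i) (n - i)%N.

Lemma mul_fps_compE h s n :
  (h * fps_comp s) n = \sum_(i < n.+1) s i * (h * G ^+ i) (n - i)%N.
Proof.
transitivity (\sum_(j < n.+1) \sum_(i < (n - j).+1)
    s i * (h j * (G ^+ i) (n - i - j)%N)).
  rewrite coefpsM; apply: eq_bigr => j _; rewrite mulr_sumr.
  by apply: eq_bigr => i _; rewrite mulrCA subnAC.
rewrite -(sum_triangle_exchange n
            (fun i j => s i * (h j * (G ^+ i) (n - i - j)%N))).
by apply: eq_bigr => i _; rewrite coefpsM mulr_sumr.
Qed.

Lemma eq_mul_fps_comp h s t n :
  (forall i, (i <= n)%N -> s i = t i) -> (h * fps_comp s) n = (h * fps_comp t) n.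
Proof.
by move=> st; rewrite !mul_fps_compE; apply: eq_bigr => i _; rewrite st // -ltnS.
Qed.

(** One step of Horner's scheme, the recursion behind every identity for composites below. *)
Lemma fps_comp_cons s :
  fps_comp s = fpsC (s 0%N) + fpsX * G * fps_comp (fps_tail s).
Proof.
apply: fpsP => n; rewrite coefpsD /fps_comp big_ord_recl expr0 -mulrA.
case: n => [|n]; first by rewrite big_ord0 coefpsXM0 mulr1.
rewrite mulr0 !add0r coefpsXMS mul_fps_compE.
by apply: eq_bigr => i _; rewrite exprS.
Qed.

(** Unrolling the recursion k times makes [Phi s] divisible by z^k, for every k. Identities for
    composites follow by taking for [Phi] the difference of the two sides. *)
Lemma fps_comp_eq0 (Phi : fps A -> fps A) :
  (forall s, Phi s = fpsX * G * Phi (fps_tail s)) -> forall s, Phi s = 0.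
Proof.
move=> PhiE s; apply: fpsP => n.
suff H m : (m <= n)%N -> Phi s m = 0 by exact: H.
elim: n m s => [|n IH] m s le; rewrite PhiE -mulrA.
  by move: le; rewrite leqn0 => /eqP ->; rewrite coefpsXM0.
case: m le => [|m] le; first by rewrite coefpsXM0.
rewrite coefpsXMS coefpsM big1 // => i _; rewrite IH ?mulr0 //; lia.
Qed.

Lemma fps_compD s t : fps_comp (s + t) = fps_comp s + fps_comp t.
Proof.
apply: fpsP => n; rewrite coefpsD /fps_comp -big_split.
by apply: eq_bigr => i _; rewrite coefpsD mulrDl.
Qed.
Lemma fps_comp0 : fps_comp 0 = 0.
Proof. by apply: fpsP => n; rewrite /fps_comp big1 // => i _; rewrite mul0r. Qed.
Lemma fps_compN s : fps_comp (- s) = - fps_comp s.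
Proof.
by apply: (addIr (fps_comp s)); rewrite -fps_compD !addNr fps_comp0.
Qed.
Lemma fps_compCM a s : fps_comp (fpsC a * s) = fpsC a * fps_comp s.
Proof.
apply: fpsP => n; rewrite coefpsCM /fps_comp mulr_sumr.
by apply: eq_bigr => i _; rewrite coefpsCM mulrA.
Qed.
Lemma fps_compXM s : fps_comp (fpsX * s) = fpsX * G * fps_comp s.
Proof.
rewrite fps_comp_cons coefpsXM0 fpsC0 add0r; congr (_ * fps_comp _).
by apply: fpsP => n; exact: coefpsXMS.
Qed.
Lemma fps_comp1 : fps_comp 1 = 1.
Proof.
rewrite fps_comp_cons.
have -> : fps_tail (1 : fps A) = 0 by apply: fpsP.
by rewrite fps_comp0 mulr0 addr0; apply: fpsP => -[].
Qed.
Lemma fps_comp_sum n (E : 'I_n -> fps A) :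
  fps_comp (\sum_(i < n) E i) = \sum_(i < n) fps_comp (E i).
Proof. by apply: big_morph; [exact: fps_compD | exact: fps_comp0]. Qed.

Lemma fps_compM s t : fps_comp (s * t) = fps_comp s * fps_comp t.
Proof.
apply/eqP; rewrite -subr_eq0; apply/eqP; move: s.
apply: fps_comp_eq0 => s; rewrite [in LHS](fps_cons s) mulrDl -mulrA !fps_compD.
rewrite fps_compCM !fps_compXM -[fpsC _]mulr1 fps_compCM fps_comp1 mulr1.
by ring.
Qed.
Lemma fps_compXn s k : fps_comp (s ^+ k) = fps_comp s ^+ k.
Proof.
by elim: k => [|k IH]; rewrite ?fps_comp1 // !exprS fps_compM IH.
Qed.

(* [E] and [e] stand for d/dz and 0, or for a derivation of [A] extended
   coefficientwise and that derivation. *)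
Lemma derivation_comp (E : fps A -> fps A) (e : A -> A) s :
  derivation E -> (forall a, E (fpsC a) = fpsC (e a)) ->
  E (fps_comp s) =
    fps_comp (fps_lift e s) + fps_comp (fps_deriv s) * E (fpsX * G).
Proof.
move=> dE Ee; apply/eqP; rewrite -subr_eq0; apply/eqP; move: s.
apply: fps_comp_eq0 => s.
(* After one Horner step on each composite, the constant terms [fpsC (e (s 0))] cancel, and so do
   the terms where [E] hits the new factor z G; what remains is z G times the same difference for
   the tail. *)
rewrite [in LHS](fps_comp_cons s) dE.1 dE.2 Ee.
rewrite [fps_comp (fps_lift e s)]fps_comp_cons [fps_deriv s]fps_deriv_cons.
rewrite fps_compD fps_compXM.
by ring.
Qed.

End Composition.

(** * Integer powers of an invertible series *)

Section Powers.
Variables (A : comPzRingType) (s t : fps A).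
Variables (s0 : s 0%N = 1) (st : s * t = 1).

Lemma ps_inv_expE k : ps_inv (ps_exp s k) = t ^+ k.
Proof.
rewrite ps_expE; have sk0 : (s ^+ k) 0%N = 1 by exact: coefps_exp0.
have stk : s ^+ k * t ^+ k = 1 by rewrite -exprMn st expr1n.
transitivity (s ^+ k * ps_inv (s ^+ k) * t ^+ k); last first.
  by rewrite mul_ps_inv ?mul1r.
by rewrite mulrAC stk mul1r.
Qed.

Lemma ps_zpow_oppE k : ps_zpow s (- k%:Z) = t ^+ k.
Proof. by case: k => [|k] //; exact: ps_inv_expE. Qed.

(** Covers the exponent 1 at [p = 0] and the exponents at most 0 in a single formula. *)
Lemma ps_zpow_1subE p : ps_zpow s (1 - p%:Z) = s * t ^+ p.
Proof.
case: p => [|p]; first by rewrite subr0 mulr1; exact: (ps_expE s 1).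
rewrite exprS mulrA st mul1r -ps_zpow_oppE; congr ps_zpow; lia.
Qed.

End Powers.

(** * Laurent series as shifted power series *)

Section LaurentShift.
Variable A : comPzRingType.
Implicit Types (s t : fps A) (k l m : int).

Lemma zshiftE k s m : zshift k s m = if k <= m then s `|m - k|%N else 0.
Proof.
rewrite /zshift -subr_ge0; case: (m - k) => n.
  by rewrite lez_nat.
by rewrite (_ : (0 <= Negz n) = false).
Qed.
Lemma eq_zshift k s t m : s = t -> zshift k s m = zshift k t m.
Proof. by move=> ->. Qed.
Lemma zshiftD k s t m : zshift k (s + t) m = zshift k s m + zshift k t m.
Proof. by rewrite !zshiftE; case: ifP => // _; rewrite addr0. Qed.
Lemma zshiftN k s m : zshift k (- s) m = - zshift k s m.
Proof. by rewrite !zshiftE; case: ifP => // _; rewrite oppr0. Qed.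
Lemma zshiftCM k a s m : zshift k (fpsC a * s) m = a * zshift k s m.
Proof. by rewrite !zshiftE; case: ifP => _; rewrite ?coefpsCM ?mulr0. Qed.
Lemma zshift0 k m : zshift k (0 : fps A) m = 0.
Proof. by rewrite zshiftE; case: ifP. Qed.
Lemma zshift_sum k m n (E : 'I_n -> fps A) :
  zshift k (\sum_(i < n) E i) m = \sum_(i < n) zshift k (E i) m.
Proof.
apply: (big_morph (fun s => zshift k s m)); last exact: zshift0.
by move=> s t; exact: zshiftD.
Qed.
Lemma zshift_sub k l s m : zshift k s (m - l) = zshift (k + l) s m.
Proof. by rewrite /zshift opprD [- k - l]addrC addrA. Qed.
Lemma zshiftXn k i s m : zshift k (fpsX ^+ i * s) m = zshift (k + i%:Z) s m.
Proof.
rewrite !zshiftE coefpsXnM; case: ifP => km; last by rewrite ifF //; lia.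
case: ifP => i1; first by rewrite ifF //; lia.
by rewrite ifT; [congr s; lia | lia].
Qed.
Lemma lconstE (a : A) m : lconst a m = zshift 0 (fpsC a) m.
Proof. by rewrite zshiftE /lconst subr0; case: m => [[|n]|n]. Qed.
Lemma lderE (p : nat) s m :
  lder p%:Z s m = zshift (p%:Z - 1) (fpsX * fps_deriv s + s *+ p) m.
Proof.
rewrite /lder; congr (zshift _ _ m); apply: fpsP => n.
rewrite coefpsD coefpsXderiv.
have -> : (s *+ p) n = s n *+ p.
  by elim: p => [|p IH]; rewrite ?mulr0n // !mulrS coefpsD IH.
by rewrite -mulrnDr.
Qed.

(* z^(p-1) Lambda_p(z), a polynomial in z with constant term -1. *)
Definition Lam_series (al : nat -> A) (p : nat) : fps A :=
  \sum_(j < p) fpsC (al j) * fpsX ^+ (p - j) - 1.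

Lemma coef_Lam_series al p j : (j < p)%N -> Lam_series al p (p - j)%N = al j.
Proof.
move=> jp; rewrite /Lam_series coefpsD coefpsN coefps1 subn_eq0 leqNgt jp subr0 coefps_sum.
rewrite (bigD1 (Ordinal jp)) //= big1 ?addr0 => [|i ij].
  by rewrite coefpsCM -[_ ^+ _]mulr1 coefpsXnM ltnn subnn mulr1.
have {}ij : (i != j :> nat)%N by [].
rewrite coefpsCM -[_ ^+ _]mulr1 coefpsXnM coefps1; case: ifP => [_|]; first exact: mulr0.
have := ltn_ord i; move: ij => /eqP ij lt nlt.
case: eqP; [lia | by rewrite mulr0].
Qed.

Lemma Lam_mulE al p k s m :
  Lam_mul al p (zshift k s) m = zshift (1 - p%:Z + k) (Lam_series al p * s) m.
Proof.
rewrite /Lam_mul /Lam_series mulrDl mulN1r zshiftD zshiftN zshift_sub addrC.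
rewrite mulr_suml zshift_sum [k + _]addrC; congr (_ - _).
apply: eq_bigr => j _; rewrite -mulrA zshiftCM zshiftXn zshift_sub.
by congr (_ * zshift _ _ _); have := ltn_ord j; lia.
Qed.

End LaurentShift.

(** * The defining expression of Lambda_p *)

Section LamExpr.
Variables (A : comPzRingType) (c : nat -> A) (Fi : fps A).
Let F : fps A := Fser c.
Variable FFi : F * Fi = 1.

(** Since f^(1-j) = z^(1-j) F Fi^j, every term of z^(1-p) f' + Lambda_p(f) is z^(1-p) times a power
    series. *)
Lemma LamExprE al p m :
  LamExpr c al p m = zshift (1 - p%:Z)
    (fps_deriv (fpsX * F) + F *
      (\sum_(j < p) fpsC (al j) * fpsX ^+ (p - j) * Fi ^+ j - Fi ^+ p)) m.
Proof.
have F0 : F 0%N = 1 by [].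
rewrite /LamExpr mulrDr mulrN !zshiftD zshiftN; congr (_ + _).
  rewrite -[1]/(1%:Z) lderE zshift_sub subrr add0r.
  by rewrite (derivation_deriv A).2 fps_derivX mul1r [F + _]addrC.
rewrite (ps_zpow_1subE F0 FFi) addrC; congr (_ - _).
rewrite mulr_sumr zshift_sum; apply: eq_bigr => j _.
have -> : F * (fpsC (al j) * fpsX ^+ (p - j) * Fi ^+ j) =
    fpsC (al j) * (fpsX ^+ (p - j) * (F * Fi ^+ j)) by ring.
rewrite (ps_zpow_1subE F0 FFi) zshiftCM zshiftXn.
by congr (_ * zshift _ _ m); have := ltn_ord j; lia.
Qed.

(** The series multiplied by z^p has coefficients A_n^p for n >= 1 and constant term 0 (exponent 1),
    so it is L_{-p} F, that is L_{-p} f divided by z. *)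
Lemma LamExpr_series al p : (forall m : int, m <= 1 -> LamExpr c al p m = 0) ->
  fpsX ^+ p * (fun n => LamExpr c al p n.+1%:Z : A) =
  fps_deriv (fpsX * F) + F *
      (\sum_(j < p) fpsC (al j) * fpsX ^+ (p - j) * Fi ^+ j - Fi ^+ p).
Proof.
move=> al0; set R := RHS.
have RE n : R n = LamExpr c al p (n%:Z + (1 - p%:Z)).
  by rewrite LamExprE -/R zshiftE ifT; [congr R; lia | lia].
apply: fpsP => n; rewrite RE coefpsXnM; case: ifP => np.
  by rewrite al0 //; lia.
by congr LamExpr; lia.
Qed.

End LamExpr.

(** * Derivations applied to the reverse series *)

Section Reversion.
Variables (A : comPzRingType) (F G : fps A).
(* With f = z F and g = z G, this is f(g(z)) = z divided by z. *)
Variable compFG : fps_comp G F * G = 1.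

(** Here H = F(g) = 1/G, P = f'(g) and Q = g'. *)
Let H := fps_comp G F.
Let P := fps_comp G (fps_deriv (fpsX * F)).
Let Q := fps_deriv (fpsX * G).

Lemma comp_reverse : fps_comp G (fpsX * F) = fpsX.
Proof. by rewrite fps_compXM -mulrA [G * _]mulrC compFG mulr1. Qed.

Lemma deriv_reverse : P * Q = 1.
Proof.
have := derivation_comp (e := fun=> 0) G (fpsX * F) (derivation_deriv A).
rewrite comp_reverse fps_derivX => -> //.
  by rewrite (_ : fps_lift _ _ = 0) ?fps_comp0 ?add0r.
by move=> a; rewrite fps_derivC fpsC0.
Qed.

Lemma derivation_reverse D : derivation D ->
  fps_lift D G = - (Q * G * fps_comp G (fps_lift D F)).
Proof.
move=> dD; have dL := derivation_lift dD.
have XL s : fps_lift D (fpsX * s) = fpsX * fps_lift D s.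
  by rewrite dL.2 fps_liftX // mul0r add0r.
have := derivation_comp G (fpsX * F) dL (fun a => fps_liftC a dD).
rewrite comp_reverse fps_liftX // !XL fps_compXM -/P => e.
(* Multiplying by z passes from L G to L g; then P = f'(g) is removed by its inverse Q. *)
apply: fpsX_inj.
transitivity (Q * (P * (fpsX * fps_lift D G))).
  by rewrite mulrA [Q * P]mulrC deriv_reverse mul1r.
have -> : P * (fpsX * fps_lift D G) = - (fpsX * G * fps_comp G (fps_lift D F)).
  by apply/eqP; rewrite -addr_eq0 addrC -e.
by ring.
Qed.

(** Common source of all the formulas: [a] is L F, [y] is G^q, and [w] stands for q G^(q-1). The
    operator [T n] varies with [n], as coefficient n uses the truncation at n. *)
Lemma Lapply_reverse (T : nat -> A -> A) (a y w : fps A) (q m : int) :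
  (forall n, derivation (T n)) ->
  (forall n i, (i <= n)%N -> T n (F i) = a i) ->
  ps_zpow G q = y -> y 0%N = 1 ->
  (forall D, derivation D -> fps_lift D y = w * fps_lift D G) ->
  Lapply T G q m = - zshift q (w * Q * G * fps_comp G a) m.
Proof.
move=> dT Ta Gq y0 yw; rewrite /Lapply Gq -zshiftN.
congr (zshift q _ m); apply: fpsP => n.
(* The value 0 that [Lapply] sets at index 0 is the true one: [y] has constant term 1 and
   derivations kill 1. *)
transitivity (T n (y n)).
  by case: n => // ; rewrite y0 derivation1.
have /(congr1 (@^~ n)) := yw _ (dT n); rewrite /fps_lift => ->.
rewrite -/(fps_lift (T n) G) derivation_reverse // mulrN !coefpsN.
by congr (- _); rewrite !mulrA; apply: eq_mul_fps_comp => i /Ta.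
Qed.

(** Up to the factor z^(p-1), this reads g' (L_{-p} f)(g) = g^(1-p) + Lambda_p(z) g', obtained by
    substituting g into z^(1-p) f' + Lambda_p(f). *)
Lemma comp_Lam_series (Fi : fps A) (al : nat -> A) p (a : fps A) :
  F * Fi = 1 ->
  fpsX ^+ p * a = fps_deriv (fpsX * F) + F *
      (\sum_(j < p) fpsC (al j) * fpsX ^+ (p - j) * Fi ^+ j - Fi ^+ p) ->
  fpsX ^+ p * (Q * G * fps_comp G a) = G * H ^+ p + Lam_series al p * Q.
Proof.
move=> FFi /(congr1 (fps_comp G)).
have compFi : fps_comp G Fi = G.
  have := congr1 (fps_comp G) FFi; rewrite fps_compM fps_comp1 -/H => HFi.
  by rewrite -[LHS]mulr1 -compFG -/H mulrCA mulrA HFi mul1r.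
have compX k : fps_comp G (fpsX ^+ k) = fpsX ^+ k * G ^+ k.
  elim: k => [|k IH]; first by rewrite fps_comp1 mulr1.
  by rewrite !exprS fps_compXM IH; ring.
rewrite fps_compM fps_compD fps_compM fps_compD fps_compN compX fps_compXn -/P -/H.
rewrite compFi fps_comp_sum.
(* Substitution turns z^(p-j) Fi^j into z^(p-j) G^p: the power of G no longer depends on j, which
   expresses Lambda_p(f(g)) = Lambda_p(z). *)
rewrite (eq_bigr (fun j : 'I_p => fpsC (al j) * fpsX ^+ (p - j) * G ^+ p)); last first.
  move=> j _; rewrite -mulrA fps_compCM fps_compM compX fps_compXn compFi.
  by rewrite -[fpsX ^+ _ * _ * _]mulrA -exprD subnK ?mulrA // ltnW.
rewrite -mulr_suml => e.
have HG : (H * G) ^+ p = 1 by rewrite compFG expr1n.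
(* The factor H^p strips the G^p that substitution attaches to z^p. *)
transitivity (Q * G * H ^+ p * (fpsX ^+ p * G ^+ p * fps_comp G a)).
  by rewrite -[LHS]mul1r -HG exprMn; ring.
rewrite e /Lam_series.
transitivity (G * H ^+ p * (P * Q) + Q * (H * G) * (H * G) ^+ p *
    (\sum_(j < p) fpsC (al j) * fpsX ^+ (p - j) - 1)).
  by rewrite exprMn; ring.
by rewrite HG compFG deriv_reverse; ring.
Qed.

(** Multiplying by P cancels Q, and alpha_j is coefficient p - j of the result, which only involves
    coefficients up to p. *)
Lemma Lam_series_inj al be p :
  (forall n, (n <= p)%N -> (Lam_series be p * Q) n = (Lam_series al p * Q) n) ->
  forall j, (j < p)%N -> be j = al j.
Proof.
move=> e j jp; rewrite -(coef_Lam_series be jp) -(coef_Lam_series al jp).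
rewrite -[Lam_series be p]mulr1 -[Lam_series al p]mulr1 -deriv_reverse.
rewrite [P * Q]mulrC !mulrA [LHS]coefpsM [RHS]coefpsM.
by apply: eq_bigr => i _; rewrite e //; have := ltn_ord i; lia.
Qed.

End Reversion.

Lemma lder_expE (A : comPzRingType) (G : fps A) p :
  lder p.+1%:Z (G ^+ p.+1) = zshift p%:Z (G ^+ p *+ p.+1 * fps_deriv (fpsX * G)).
Proof.
apply: boolp.funext => m; rewrite lderE (_ : p.+1%:Z - 1 = p); last lia.
apply: eq_zshift.
have dz := derivation_deriv A.
by rewrite derivationX // dz.2 fps_derivX exprSr; ring.
Qed.

Lemma sum_nat_delta (R : pzSemiRingType) n (b : nat -> R) j :
  \sum_(1 <= l < n.+1) b l * (l == j)%:R = if (1 <= j <= n)%N then b j else 0.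
Proof.
rewrite -ltnS; case: ifP => jn; last first.
  rewrite big_nat_cond big1 // => l /andP[ln _].
  by case: eqP => [e|]; rewrite ?mulr0 //; move: ln; rewrite e jn.
rewrite (bigD1_seq j) ?mem_index_iota ?iota_uniq //= eqxx mulr1 big1 ?addr0 //.
by move=> l /negbTE ->; rewrite mulr0.
Qed.

(** * The truncated operators acting on F *)

Section Operators.
Variables (A : comPzRingType) (c : nat -> A) (d : nat -> A -> A).
Variable der_d : forall n, derivation (d n).
Variable d_c : forall n m, (1 <= n)%N -> (1 <= m)%N -> d n (c m) = (n == m)%:R.
Let F : fps A := Fser c.

Lemma derivation_Lpos k N : derivation (Lpos c d k N).
Proof. by apply: derivation_add => //; apply: derivation_comb. Qed.
Lemma derivation_Lzero N : derivation (Lzero c d N).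
Proof. by apply: derivation_comb. Qed.
Lemma derivation_Lneg al p N : derivation (Lneg c al d p N).
Proof. by apply: derivation_comb. Qed.

Lemma Fser0 : F 0%N = 1. Proof. by []. Qed.
Lemma FserS i : F i.+1 = c i.+1. Proof. by []. Qed.

Lemma comb_c (b : nat -> A) n i : (1 <= i <= n)%N ->
  \sum_(1 <= l < n.+1) b l * d l (c i) = b i.
Proof.
move=> i1n; have := sum_nat_delta n b i; rewrite i1n => <-.
by apply: eq_big_nat => l /andP[l1 _]; rewrite d_c //; case/andP: i1n.
Qed.

(** This is L_k f = z^(k+1) f' divided by z. *)
Lemma Lpos_F k n i : (1 <= k)%N -> (i <= n)%N ->
  Lpos c d k n (F i) = (fpsX ^+ k * fps_deriv (fpsX * F)) i.
Proof.
move=> k1; rewrite coefpsXnM; case: i => [|i] iN.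
  by rewrite Fser0 derivation1 ?k1 //; exact: derivation_Lpos.
rewrite coef_derivXM /Lpos FserS d_c //.
(* Below k both sides vanish; above k only the summand l = i + 1 - k survives, within the
   truncation; at k only the leading [d k] contributes, matching f'(0) = 1. *)
case: (ltngtP i.+1 k) => ik.
- rewrite big_nat_cond big1 ?addr0 // => l /andP[/andP[l1 _] _].
  rewrite d_c ?addn_gt0 ?l1 // (_ : (_ == _) = false) ?mulr0 //; lia.
- rewrite add0r (eq_big_nat _ _
    (F2 := fun l => (l.+1%:R * c l) * (l == i.+1 - k)%N%:R)); last first.
    move=> l /andP[l1 _]; rewrite d_c ?addn_gt0 ?l1 //; congr (_ * _%:R); lia.
  rewrite sum_nat_delta ifT; last lia.
  rewrite mulr_natl; have : (0 < i.+1 - k)%N by lia.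
  by case: (i.+1 - k)%N.
- rewrite -ik subnn big_nat_cond big1 ?addr0 // => l /andP[/andP[l1 _] _].
  rewrite d_c ?addn_gt0 ?l1 // (_ : (_ == _) = false) ?mulr0 //; lia.
Qed.

(** This is L_0 f = z f' - f = z^2 F' divided by z. *)
Lemma Lzero_F n i : (i <= n)%N -> Lzero c d n (F i) = (fpsX * fps_deriv F) i.
Proof.
rewrite coefpsXderiv; case: i => [|i] iN.
  by rewrite Fser0 derivation1 ?mulr0n //; exact: derivation_Lzero.
by rewrite /Lzero FserS comb_c ?mulr_natl.
Qed.

(** At [i = 0] the left side is 0, so the coefficient at exponent 1 has to vanish. *)
Lemma Lneg_F al p n i : LamExpr c al p 1 = 0 -> (i <= n)%N ->
  Lneg c al d p n (F i) = LamExpr c al p i.+1%:Z.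
Proof.
move=> al1; case: i => [|i] iN.
  by rewrite Fser0 derivation1 ?al1 //; exact: derivation_Lneg.
by rewrite /Lneg FserS comb_c.
Qed.

End Operators.

(** * The five formulas *)

Unset Implicit Arguments.

Theorem theorem5p1 (A : comPzRingType) (c : nat -> A) (d : nat -> A -> A)
  (* d n = partial derivative w.r.t. c_n: a derivation with d_n c_m = [n = m] *)
  (d_add : forall n x y, d n (x + y) = d n x + d n y)
  (d_mul : forall n x y, d n (x * y) = d n x * y + x * d n y)
  (d_c : forall n m, (1 <= n)%N -> (1 <= m)%N -> d n (c m) = (n == m)%:R)
  (* f^{-1}(z) = z G(z) with G(0) = 1 is the reverse series: f(f^{-1}(z)) = z *)
  (G : nat -> A) (G0 : G 0%N = 1)
  (Ginv : forall m, \sum_(n < m.+1) Fser c n * ps_exp G n.+1 (m - n)%N = (m == 0%N)%:R)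
  (* al p = coefficients alpha_j of Lambda_p, characterized as in the context *)
  (al : nat -> nat -> A)
  (al_spec : forall p (m : int), m <= 1 -> LamExpr c (al p) p m = 0) :
  (* (1) *)
  (forall k, (1 <= k)%N -> forall m : int,
     Lapply (Lpos c d k) G 1 m = - zshift (Posz k.+1) (ps_zpow G (Posz k.+1)) m) /\
  (* (2) *)
  (forall m : int,
     Lapply (Lzero c d) G 1 m = - zshift 1 G m + zshift 1 (fun n => lder 1 G (n%:Z)) m) /\
  (forall m : int,
     Lapply (Lneg c (al 1%N) d 1) G 1 m
     = lconst (-1) m + lder 1 G m + 2%:R * c 1%N * lder 1 G (m - 1)) /\
  (* (3) *)
  (forall p, (2 <= p)%N ->
     (forall m : int,
        Lapply (Lneg c (al p) d p) G 1 m
        = - zshift (1 - p%:Z) (ps_zpow G (1 - p%:Z)) m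
          - Lam_mul (al p) p (lder 1 G) m) /\
     (forall m : int, m < 2 ->
        zshift (1 - p%:Z) (ps_zpow G (1 - p%:Z)) m
        + Lam_mul (al p) p (lder 1 G) m = 0) /\
     (forall be : nat -> A,
        (forall m : int, m < 2 ->
           zshift (1 - p%:Z) (ps_zpow G (1 - p%:Z)) m
           + Lam_mul be p (lder 1 G) m = 0) ->
        forall j, (j < p)%N -> be j = al p j)) /\
  (* (4) *)
  (forall k, (1 <= k)%N -> forall m : int,
     Lapply (Lpos c d k) G (- k%:Z) m = lconst (k%:R) m) /\
  (* (5) *)
  (forall p, (1 <= p)%N -> forall m : int,
     Lapply (Lneg c (al p) d p) G (Posz p) m
     = lconst (- p%:R) m - Lam_mul (al p) p (lder (Posz p) (ps_zpow G (Posz p))) m).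
Proof.
have der_d n : derivation (d n) by split=> x y.
pose F : fps A := Fser c; pose g : fps A := G.
pose Fi : fps A := ps_inv F.
have FFi : F * Fi = 1 by apply: mul_ps_inv.
pose H := fps_comp g F; pose Q := fps_deriv (fpsX * g).
(* [Ginv] is f(g) = z with one factor z removed: the sum of F_n z^n G^(n+1) is G F(g). *)
have HG : H * g = 1.
  apply: fpsP => m; rewrite mulrC mul_fps_compE coefps1 -Ginv.
  by apply: eq_bigr => i _; rewrite ps_expE exprS.
have GH : g * H = 1 by rewrite mulrC.
have PQ := deriv_reverse HG; rewrite -/Q in PQ.
set P := fps_comp _ _ in PQ.
have zp1 : ps_zpow g 1 = g by rewrite -[RHS]expr1 -ps_expE.
have w1 D : derivation D -> fps_lift D g = 1 * fps_lift D g by rewrite mul1r.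
have lder1 : lder 1 G = zshift 0 Q.
  by have := lder_expE g 0; rewrite expr0 mulr1n mul1r.
have Qn n : Q n = G n *+ n.+1 by exact: coef_derivXM.
(* Common form of (1) and (4): (z^k f')(g) = (z G)^k P, and P cancels against Q. *)
have Lpos_rev k q (y w : fps A) m : (1 <= k)%N -> ps_zpow g q = y -> y 0%N = 1 ->
    (forall D, derivation D -> fps_lift D y = w * fps_lift D g) ->
    Lapply (Lpos c d k) G q m = - zshift q (fpsX ^+ k * (w * g ^+ k.+1)) m.
  move=> k1 gq y0 yw.
  rewrite (Lapply_reverse HG m (derivation_Lpos c der_d k)
             (fun n i => Lpos_F der_d d_c k1) gq y0 yw) -/Q.
  congr (- _); apply: eq_zshift.
  rewrite fps_compM -/P; have -> : fps_comp g (fpsX ^+ k) = (fpsX * g) ^+ k.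
    by rewrite -[fpsX in LHS]mulr1 fps_compXn fps_compXM fps_comp1 mulr1.
  rewrite exprMn exprS; transitivity (P * Q * (w * g * (fpsX ^+ k * g ^+ k))).
    by ring.
  by rewrite PQ; ring.
(* Common form of (3) and (5); the exponent drops from q to q - p because [comp_Lam_series]
   determines z^p times the wanted series. *)
have Lneg_rev p q (y w : fps A) m : ps_zpow g q = y -> y 0%N = 1 ->
    (forall D, derivation D -> fps_lift D y = w * fps_lift D g) ->
    Lapply (Lneg c (al p) d p) G q m =
    - zshift (q - p%:Z) (w * (g * H ^+ p + Lam_series (al p) p * Q)) m.
  move=> gq y0 yw; have al1 := al_spec p 1 (lexx 1).
  rewrite (Lapply_reverse HG m (derivation_Lneg c der_d (al p) p)
             (fun n i => Lneg_F der_d d_c al1) gq y0 yw) -/Q.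
  rewrite -(comp_Lam_series HG FFi (LamExpr_series FFi (al_spec p))) -/Q.
  rewrite [w * (_ * _)]mulrCA zshiftXn subrK.
  by rewrite !mulrA.
have part3 p m : Lapply (Lneg c (al p) d p) G 1 m
    = - zshift (1 - p%:Z) (ps_zpow G (1 - p%:Z)) m
      - Lam_mul (al p) p (lder 1 G) m.
  rewrite (Lneg_rev p 1 g 1 m zp1 G0 w1) mul1r zshiftD lder1 Lam_mulE addr0.
  by rewrite (ps_zpow_1subE G0 GH) opprD.
split; last split; last split; last split; last split.
- move=> k k1 m; rewrite (Lpos_rev k 1 g 1 m k1 zp1 G0 w1) mul1r zshiftXn.
  by rewrite /ps_zpow ps_expE; congr (- zshift _ _ m); lia.
- move=> m.
  have -> : (fun n => lder 1 G n%:Z) = Q.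
    by apply: boolp.funext => n; rewrite lder1 zshiftE subr0.
  rewrite (Lapply_reverse HG m (derivation_Lzero c der_d)
             (Lzero_F der_d d_c) zp1 G0 w1) -/Q -[zshift 1 G m]/(zshift 1 g m).
  rewrite -!zshiftN -zshiftD.
  apply: eq_zshift.
  have -> : fpsX * fps_deriv F = fps_deriv (fpsX * F) - F.
    by rewrite (derivation_deriv A).2 fps_derivX; ring.
  rewrite fps_compD fps_compN -/P -/H.
  transitivity (- (g * (P * Q)) + Q * (H * g)); first by ring.
  by rewrite PQ HG !mulr1.
- move=> m; rewrite part3 /Lam_mul lder1 big_ord1 subrr !subr0.
  (* The coefficient of z in f' + Lambda_1(f) is 2 c_1 + alpha_0, and it vanishes. *)
  have -> : al 1%N 0%N = - (2%:R * c 1%N).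
    have : c 1%N *+ 2 + (- 0 + al 1%N 0%N * (F * 1) 0%N) = 0.
      by have := al_spec 1%N 1 (lexx 1); rewrite /LamExpr big_ord1.
    rewrite mulr1 oppr0 add0r [F _]Fser0 mulr1 addrC => /eqP.
    by rewrite addr_eq0 mulr_natl => /eqP.
  rewrite (_ : ps_zpow G 0 = (1 : fps A)) // lconstE fpsCN (fpsC_nat A 1) zshiftN.
  by ring.
- move=> p p2; split; first by move=> m; exact: part3.
  (* By [part3] the expression is -L_{-p} g, and [Lapply] starts at z^1 with coefficient 0. *)
  have vanish m : m < 2 -> zshift (1 - p%:Z) (ps_zpow G (1 - p%:Z)) m
      + Lam_mul (al p) p (lder 1 G) m = 0.
    move=> m2; apply: oppr_inj; rewrite opprD -part3 oppr0 /Lapply zshiftE.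
    case: ifP => // m1; rewrite (_ : `|m - 1|%N = 0%N) //; lia.
  split=> // be be0 j jp.
  (* Indices n <= p correspond to exponents n + 1 - p <= 1, where both expressions vanish; their
     common term g^(1-p) cancels. *)
  apply: (Lam_series_inj HG _ jp) => n np.
  have m2 : n%:Z + (1 - p%:Z) < 2 by lia.
  have := etrans (be0 _ m2) (esym (vanish _ m2)) => /addrI.
  rewrite lder1 !Lam_mulE addr0 !zshiftE ifT; last lia.
  by rewrite ifT ?addrK; last lia.
- move=> k k1 m; have H0 : H 0%N = 1.
    by have := congr1 (@^~ 0%N) HG; rewrite coefpsM0 [g _]G0 mulr1.
  case: k k1 => // k k1.
  (* As H = 1/G, the derivative of G^(-k-1) carries the factor -(k+1) H^(k+2), written here as it
     comes out of the power and inverse rules. *)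
  rewrite (Lpos_rev k.+1 _ (H ^+ k.+1) (- (H ^+ k *+ k.+1 * H ^+ 2)) m k1); first last.
  + move=> D dD; have dL := derivation_lift dD.
    by rewrite derivationX // (derivation_inv dL GH); ring.
  + exact: coefps_exp0.
  + exact: ps_zpow_oppE.
  rewrite zshiftXn addNr lconstE -zshiftN; apply: eq_zshift.
  transitivity ((H * g) ^+ k.+2 *+ k.+1); first by rewrite exprMn !exprS; ring.
  by rewrite HG expr1n fpsC_nat.
- case=> // p _ m; rewrite (Lneg_rev p.+1 _ (g ^+ p.+1) (g ^+ p *+ p.+1)); first last.
  + move=> D dD; exact: derivationX (derivation_lift dD) _ _.
  + exact: coefps_exp0.
  + exact: ps_expE.
  rewrite /ps_zpow ps_expE lder_expE Lam_mulE -/Q lconstE.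
  rewrite (_ : 1 - _ + _ = 0) ?subrr; last lia.
  rewrite -!zshiftN -zshiftD; apply: eq_zshift.
  (* The constant comes from w G H^(p+1) = (p+1) (G H)^(p+1), so 1 is rewritten as (G H)^(p+1). *)
  rewrite fpsCN fpsC_nat -[in RHS](expr1n _ p.+1) -GH exprMn [g ^+ p.+1]exprSr.
  by ring.
Qed.
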